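(* Let $q$ be a prime power, $2\le n\le m$, $\mathcal{C}\subseteq\mathrm{Mat}$ a rank-metric code and $t=\mathrm{maxrk}(\mathcal{C})$. The following are equivalent: (1) $\mathcal{C}$ is an optimal anticode; (2) $\{\rho_{\mathrm c}(\mathcal{C},J)\mid J\subseteq\mathbb{F}_q^n\}=\{0,1,\dots,t\}$, or $m=n$ and $\{\rho_{\mathrm r}(\mathcal{C},J)\mid J\subseteq\mathbb{F}_q^n\}=\{0,1,\dots,t\}$; (3) $\rho_{\mathrm c}(\mathcal{C},\mathbb{F}_q^n)=t$, or $m=n$ and $\rho_{\mathrm r}(\mathcal{C},\mathbb{F}_q^n)=t$. In particular, the $q$-polymatroid associated to an optimal anticode is a $q$-matroid.
   Context: $\mathrm{Mat}$ is the $\mathbb{F}_q$-space of $n\times m$ matrices over $\mathbb{F}_q$; a rank-metric code is an $\mathbb{F}_q$-linear subspace; $\mathrm{maxrk}(\mathcal{C})=\max\{\mathrm{rk}(M)\mid M\in\mathcal{C}\}$, and $\mathcal{C}$ is an optimal anticode if $\dim\mathcal{C}=m\cdot\mathrm{maxrk}(\mathcal{C})$. For subspaces $J\subseteq\mathbb{F}_q^n$, $K\subseteq\mathbb{F}_q^m$: $\mathcal{C}(J,\mathrm c)=\{M\in\mathcal{C}\mid\mathrm{colsp}(M)\subseteq J\}$, $\mathcal{C}(K,\mathrm r)=\{M\in\mathcal{C}\mid\mathrm{rowsp}(M)\subseteq K\}$, $\rho_{\mathrm c}(\mathcal{C},J)=(\dim\mathcal{C}-\dim\mathcal{C}(J^\perp,\mathrm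 c))/m$, $\rho_{\mathrm r}(\mathcal{C},K)=(\dim\mathcal{C}-\dim\mathcal{C}(K^\perp,\mathrm r))/n$ ($\perp$ for the standard inner product). The associated $q$-polymatroids are $(\mathbb{F}_q^n,\rho_{\mathrm c}(\mathcal{C},\cdot))$ and $(\mathbb{F}_q^m,\rho_{\mathrm r}(\mathcal{C},\cdot))$. A $q$-polymatroid $(\mathbb{F}_q^N,\rho)$ is a real-valued function $\rho$ on subspaces with $0\le\rho(A)\le\dim A$, monotone, and submodular ($\rho(A+B)+\rho(A\cap B)\le\rho(A)+\rho(B)$); it is a $q$-matroid if $\rho$ is integer-valued. *)

(* Defs.v *)
From HB Require Import structures.
From mathcomp Require Import all_boot all_order all_algebra.
Set Implicit Arguments. Unset Strict Implicit. Unset Printing Implicit Defensive.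
Import Order.TTheory GRing.Theory Num.Theory.
Local Open Scope ring_scope.

Section RankMetric.
Variable F : finFieldType.

(* Orthogonal complement of a subspace J of F^N w.r.t. the standard inner
   product u . v = u *m v^T.  (F finite, so we take the span of the finite set
   of orthogonal vectors, which is itself that set.) *)
Definition perpv N (J : {vspace 'rV[F]_N}) : {vspace 'rV[F]_N} :=
  <<[seq v <- enum 'rV[F]_N |
      [forall u : 'rV[F]_N, (u \in J) ==> (u *m v^T == 0%R)]]>>%VS.

Definition colsp_sub n m (M : 'M[F]_(n, m)) (J : {vspace 'rV[F]_n}) : bool :=
  [forall j : 'I_m, (col j M)^T \in J].

Definition rowsp_sub n m (M : 'M[F]_(n, m)) (K : {vspace 'rV[F]_m}) : bool :=
  [forall i : 'I_n, row i M \in K].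

Definition subcode_c n m (C : {vspace 'M[F]_(n, m)}) (J : {vspace 'rV[F]_n})
  : {vspace 'M[F]_(n, m)} :=
  <<[seq M <- enum 'M[F]_(n, m) | (M \in C) && colsp_sub M J]>>%VS.

Definition subcode_r n m (C : {vspace 'M[F]_(n, m)}) (K : {vspace 'rV[F]_m})
  : {vspace 'M[F]_(n, m)} :=
  <<[seq M <- enum 'M[F]_(n, m) | (M \in C) && rowsp_sub M K]>>%VS.

Definition rho_c n m (C : {vspace 'M[F]_(n, m)}) (J : {vspace 'rV[F]_n}) : rat :=
  ((\dim C)%:R - (\dim (subcode_c C (perpv J)))%:R) / m%:R.

Definition rho_r n m (C : {vspace 'M[F]_(n, m)}) (K : {vspace 'rV[F]_m}) : rat :=
  ((\dim C)%:R - (\dim (subcode_r C (perpv K)))%:R) / n%:R.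

Definition maxrk n m (C : {vspace 'M[F]_(n, m)}) : nat :=
  \max_(M : 'M[F]_(n, m) | M \in C) \rank M.

Definition optimal_anticode n m (C : {vspace 'M[F]_(n, m)}) : Prop :=
  \dim C = (m * maxrk C)%N.

End RankMetric.

(* Main.v *)
(* Order the positions of a matrix lexicographically and let P be the set of
   leading positions of the codewords; dim C <= |P|.  A partial permutation
   matrix inside P of size k forces a codeword of rank at least k (Meshulam), so
   by averaging over the cyclic shifts of a permutation an optimal anticode has
   P equal to t full rows or, if m = n, to t full columns.  In the first case C
   is the graph of a linear map X |-> (other rows) on t x m matrices; each row
   l X lies in the row space of X whenever X has rank t, and as t < m this
   forces l X = a X for a fixed vector a.  Hence C = {A X | X} with A of rank t,
   and rho_c(C, J) is the rank of B A for any matrix B with row space J.  The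
   case of columns follows by transposition. *)
Require Import Defs.
From HB Require Import structures.
From mathcomp Require Import all_boot all_order all_algebra all_fingroup.
Set Implicit Arguments. Unset Strict Implicit. Unset Printing Implicit Defensive.
Import Order.TTheory GRing.Theory Num.Theory.
Local Open Scope ring_scope.

(** * Permutations in a square 0/1 array *)

Lemma perm_map2 (T : finType) (x y a b : T) :
  x != y -> a != b -> exists s : {perm T}, s x = a /\ s y = b.
Proof.
move=> xy ab; pose z := tperm x a y.
have az : z != a by rewrite /z -{2}(tpermL x a) (inj_eq perm_inj) eq_sym.
exists (tperm x a * tperm z b)%g; rewrite !permM tpermL tpermL; split=> //.
by rewrite tpermD // eq_sym.
Qed.

(* The cyclic shifts of a permutation partition the square grid, so [f] has
   exactly [t] ones along every permutation; exchanging two values of a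
   permutation then compares the four corners of any rectangle. *)
Lemma transversal_constant m t (f : 'I_m -> 'I_m -> bool) :
  (forall s : {perm 'I_m}, \sum_i f i (s i) <= t)%N ->
  (m * t <= \sum_i \sum_j f i j)%N ->
  (forall i a b, f i a = f i b) \/ (forall i j a, f i a = f j a).
Proof.
case: m f => [|m] f le_t ge_mt; first by left=> -[].
have eq_t (s : {perm 'I_m.+1}) : (\sum_i f i (s i) = t)%N.
  pose s_ (c : 'I_m.+1) : {perm 'I_m.+1} := (perm (addIr c) * s)%g.
  have sumE : (\sum_c \sum_i f i (s_ c i) = \sum_i \sum_j f i j)%N.
    rewrite exchange_big; apply: eq_bigr => i _.
    rewrite [RHS](reindex_inj (h := fun c => s_ c i)) //= => c d.
    by rewrite !permM !permE => /perm_inj /addrI.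
  (* A single permutation with fewer than [t] ones would push the total over its shifts below
     [m * t], contradicting [ge_mt]. *)
  apply/eqP; rewrite eqn_leq le_t leqNgt; apply/negP => lt_t.
  move: ge_mt; rewrite -sumE leqNgt => /negP; apply.
  rewrite (bigD1 (0 : 'I_m.+1)) //= [X in (_ < X)%N]mulSn.
  have -> : s_ 0 = s by apply/permP => i; rewrite permM permE addr0.
  rewrite -addSn leq_add //.
  apply: leq_trans (leq_sum _ (fun c _ => le_t (s_ c))) _.
  by rewrite sum_nat_const cardC1 card_ord mulnC mulnC.
have swap i j a b : i != j -> a != b -> (f i a + f j b = f i b + f j a)%N.
  move=> ij ab; have [s [si sj]] := perm_map2 ij ab.
  have := eq_t s; rewrite -(eq_t (s * tperm a b)%g).
  rewrite (bigD1 i) // [in RHS](bigD1 i) //= (bigD1 j) 1?eq_sym //=.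
  rewrite [in RHS](bigD1 j) 1?eq_sym //= !permM si sj tpermL tpermR !addnA.
  under [in X in _ = X -> _]eq_bigr => k /andP[ki kj].
    rewrite permM tpermD; first over.
      by rewrite -si (inj_eq perm_inj) eq_sym.
    by rewrite -sj (inj_eq perm_inj) eq_sym.
  by move/addIn.
have [const|] := boolP [forall i, forall a, forall b, f i a == f i b].
  by left=> i a b; move/forallP/(_ i)/forallP/(_ a)/forallP/(_ b)/eqP: const.
rewrite negb_forall => /existsP[i]; rewrite negb_forall => /existsP[a].
rewrite negb_forall => /existsP[b fiab]; right.
suff col k c : f k c = f i c by move=> k l c; rewrite !col.
have [->//|ki] := eqVneq k i.
have ab : a != b by apply: contraNneq fiab => ->.
(* For bits, [f i a + f k d = f i d + f k a] with [f i a != f i d] forces row [k] to agree with row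
   [i] at [a] and [d]. Once agreement at [a] is known, the same relation gives it in every
   column. *)
have col2 d : a != d -> f i a != f i d -> f k d = f i d /\ f k a = f i a.
  move=> ad; have := swap i k a d; rewrite eq_sym ki ad => /(_ isT isT).
  by case: (f i a) (f i d) (f k a) (f k d) => [] [] [] [].
have [fkb fka] := col2 b ab fiab.
have [<-//|ac] := eqVneq a c.
have := swap i k a c; rewrite eq_sym ki ac => /(_ isT isT).
by rewrite fka; case: (f i a) (f i c) (f k c) => [] [] [].
Qed.

(** * Two determinant tools *)

Section Rank.
Variable F : fieldType.

(** A permutation [s] with a nonzero term satisfies [c i <= c (s i)] for all [i]. Both sides have
    the same sum, so equality holds throughout and [s] is the identity. *)
Lemma det_trig_injective n (T : 'M[F]_n) (c : 'I_n -> nat) :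
  injective c -> (forall i j, (c j < c i)%N -> T i j = 0) ->
  \det T = \prod_i T i i.
Proof.
move=> c_inj T0; rewrite /determinant (bigD1 1%g) //= odd_perm1 mul1r.
rewrite [X in _ + X]big1 ?addr0 => [|s s1].
  by apply: eq_bigr => i _; rewrite perm1.
suff [i ci] : exists i, (c (s i) < c i)%N by rewrite (bigD1 i) //= T0 ?mul0r ?mulr0.
apply/existsP; apply: contraNT s1; rewrite negb_exists => /forallP le_c.
have le_cs i : (c i <= c (s i) ?= iff (c i == c (s i)))%N.
  by split=> //; rewrite leqNgt; apply: le_c.
have := (leqif_sum (fun i (_ : true) => le_cs i)).2.
rewrite [X in _ == X](_ : _ = (\sum_i c i)%N); last first.
  by rewrite [RHS](reindex_inj (h := s)) //; apply: perm_inj.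
rewrite eqxx => /esym/forallP cs; apply/eqP/permP => i.
by rewrite perm1; apply/esym/c_inj/eqP; have := cs i.
Qed.

(** Multilinearity in row [i] gives [\det T0 = \det T1 + \det T], so the first two cannot both
    vanish. *)
Lemma det_row_update n (T T0 T1 : 'M[F]_n) i :
  row i T0 = row i T1 + row i T -> row' i T0 = row' i T -> row' i T1 = row' i T ->
  \det T != 0 -> \det T0 != 0 \/ \det T1 != 0.
Proof.
move=> rowE T0E T1E T_n0.
have := @determinant_multilinear _ _ T0 T1 T i 1 1.
rewrite !scale1r !mul1r rowE T0E T1E => /(_ erefl erefl erefl) ->.
by have [->|] := eqVneq (\det T1) 0; [rewrite add0r; left|right].
Qed.

End Rank.

(** * Leading positions of codewords *)

Section Leading.
Variables (F : finFieldType) (n m : nat).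
Implicit Types (M : 'M[F]_(n, m)) (C : {vspace 'M[F]_(n, m)}).

(** The number [i * m + j] encodes the lexicographic order on positions. *)
Definition leading M (i : 'I_n) (j : 'I_m) : bool :=
  (M i j != 0) &&
  [forall p : 'I_n * 'I_m, (p.1 * m + p.2 < i * m + j)%N ==> (M p.1 p.2 == 0)].

Definition leading_pos C i j : bool := [exists M, (M \in C) && leading M i j].

Lemma leadingP M (i : 'I_n) (j : 'I_m) :
  leading M i j -> M i j != 0 /\
    forall (i' : 'I_n) (j' : 'I_m), (i' * m + j' < i * m + j)%N -> M i' j' = 0.
Proof.
case/andP=> Mij /forallP M0; split=> // i' j' lt.
by have /implyP/(_ lt)/eqP := M0 (i', j').
Qed.

Lemma leading_above M (i i' : 'I_n) (j j' : 'I_m) :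
  leading M i j -> (i' < i)%N -> M i' j' = 0.
Proof.
move=> /leadingP[_ M0] lt_i; apply: M0.
apply: leq_trans (leq_addr j _); apply: (@leq_trans (i'.+1 * m)).
  by rewrite mulSn addnC ltn_add2r.
by rewrite leq_mul2r lt_i orbT.
Qed.

Lemma exists_leading M : M != 0 -> exists i j, leading M i j.
Proof.
move=> M_n0; have [p Mp] : exists p : 'I_n * 'I_m, M p.1 p.2 != 0.
  apply/existsP; apply: contraNT M_n0; rewrite negb_exists => /forallP M0.
  by apply/eqP/matrixP => i j; have := M0 (i, j); rewrite mxE negbK => /eqP.
pose P := [pred q : 'I_n * 'I_m | M q.1 q.2 != 0].
case: (@arg_minnP _ p P (fun q => q.1 * m + q.2)%N Mp) => -[i j] /= Mij min.
exists i, j; rewrite /leading Mij; apply/forallP => q; apply/implyP.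
by apply: contraTT; rewrite -leqNgt => /min.
Qed.

Lemma sum_deltaE (D : {set 'I_n}) i j :
  (\sum_(k in D) delta_mx k k : 'M[F]_n) i j = ((i \in D) && (i == j))%:R.
Proof.
rewrite summxE; have [iD|iD] := boolP (i \in D) => /=.
  rewrite (bigD1 i) //= mxE eqxx eq_sym big1 ?addr0 // => k /andP[_ ki].
  by rewrite mxE eq_sym (negPf ki).
rewrite big1 // => k kD; rewrite mxE.
by case: eqP kD => // <-; rewrite (negPf iD).
Qed.

Lemma mxrank_sum_delta (D : {set 'I_n}) :
  (\rank (\sum_(i in D) delta_mx i i : 'M[F]_n)%R <= #|D|)%N.
Proof.
rewrite -sum1_card.
apply: (big_ind2 (fun (A : 'M_n) (a : nat) => \rank A <= a)%N) => [|A a B b Aa Bb|i _].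
- by rewrite mxrank0.
- exact: leq_trans (mxrank_add _ _) (leq_add Aa Bb).
- by rewrite mxrank_delta.
Qed.

(* Row by row, the leading rows are replaced by rows of a single codeword
   [M]: the row of index [i] becomes [x * A i + (earlier terms)], and the
   determinant stays nonzero for [x = 0] or for [x = 1]. *)
Lemma leading_rank C (s : 'I_n -> 'I_m) : injective s ->
  exists2 M, M \in C & (\sum_i leading_pos C i (s i) <= \rank M)%N.
Proof.
move=> s_inj; pose D := [set i | leading_pos C i (s i)].
have [A AP] : exists A : 'I_n -> 'M[F]_(n, m),
    forall i, i \in D -> A i \in C /\ leading (A i) i (s i).
  suff: forall i, exists A, i \in D -> A \in C /\ leading A i (s i).
    exact: fin_all_exists.
  move=> i; have [|_] := boolP (i \in D); last by exists 0.
  by rewrite inE => /existsP[M /andP[]]; exists M.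
(* Columns are reindexed by [s], and rows outside [D] are unit rows. For [k = 0] the matrix is
   triangular in the order of the [s i]; for [k = n] all rows in [D] come from the single codeword
   [M]. *)
pose T k M : 'M[F]_n := \matrix_(i, j)
  if i \in D then (if (i < k)%N then M else A i) i (s j) else (i == j)%:R.
have step k : (k <= n)%N -> exists2 M, M \in C & \det (T k M) != 0.
  elim: k => [_|k IHk lt_k].
    exists 0; first exact: mem0v.
    rewrite (@det_trig_injective _ _ _ s) => [||i j lt_s].
    - apply/prodf_neq0 => i _; rewrite mxE ltn0 eqxx.
      by case: ifP => [/AP[_ /leadingP[]]|_] //; rewrite oner_neq0.
    - by move=> i j /val_inj/s_inj.
    - rewrite mxE ltn0; case: ifP => [/AP[_ /leadingP[_ ->]]//|_].
        by rewrite ltn_add2l.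
      by case: eqP lt_s => // ->; rewrite ltnn.
  have [M MC detM] := IHk (ltnW lt_k); pose i0 := Ordinal lt_k.
  have ltS (i : 'I_n) : i != i0 -> (i < k.+1)%N = (i < k)%N.
    by move=> ii0; rewrite ltnS leq_eqVlt (negPf (ii0 : val i != k)).
  have [i0D|i0D] := boolP (i0 \in D); last first.
    exists M => //; suff -> : T k.+1 M = T k M by [].
    apply/matrixP => i j; rewrite !mxE; case: ifP => // iD.
    by rewrite ltS //; apply: contraNneq i0D => <-.
  have [A0C A0] := AP _ i0D.
  (* [A i0] vanishes above its leading row [i0], so adding it to [M] does not disturb the earlier
     rows: the three matrices differ only in row [i0]. *)
  case: (@det_row_update _ _ (T k M) (T k.+1 (M + A i0)) (T k.+1 M) i0) => //.
  - by apply/rowP => j; rewrite !mxE i0D /= ltnSn ltnn mxE.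
  - apply/matrixP => i j; rewrite !mxE; set i' := lift i0 i.
    case: ifP => // iD; rewrite ltS 1?eq_sym ?neq_lift //.
    by case: ifP => // lt_i; rewrite mxE (leading_above _ A0) ?addr0.
  - apply/matrixP => i j; rewrite !mxE; set i' := lift i0 i.
    by case: ifP => // iD; rewrite ltS 1?eq_sym ?neq_lift.
  - by exists (M + A i0); rewrite ?memvD.
  - by exists M.
have [M MC detM] := step n (leqnn n); exists M => //.
have DE : (\sum_i leading_pos C i (s i) = #|D|)%N.
  rewrite -sum1_card [RHS]big_mkcond; apply: eq_bigr => i _.
  by rewrite inE; case: leading_pos.
have rankT : \rank (T n M) = n by apply/mxrank_unit; rewrite unitmxE unitfE.
(* The unit rows contribute at most [#|~: D|] to the rank [n] of [T n M]; the remaining rows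
   contribute at most [\rank M]. *)
rewrite DE -(leq_add2r #|~: D|) cardsC card_ord -{1}rankT.
have -> : T n M = (\sum_(i in D) delta_mx i i) *m (M *m colsub s 1%:M)
                  + \sum_(i in ~: D) delta_mx i i.
  apply/matrixP => i j; rewrite mulmx_colsub mulmx1 [RHS]mxE sum_deltaE [LHS]mxE.
  rewrite mxE ltn_ord in_setC (bigD1 i) //= sum_deltaE eqxx andbT.
  rewrite big1 ?addr0 => [|k ki]; last first.
    by rewrite sum_deltaE eq_sym (negPf ki) andbF mul0r.
  by rewrite mxE; case: (i \in D); rewrite ?mul1r ?mul0r ?addr0 ?add0r.
apply: leq_trans (mxrank_add _ _) _; apply: leq_add (mxrank_sum_delta _).
exact: leq_trans (mxrankM_maxr _ _) (mxrankM_maxl _ _).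
Qed.

(** Restriction to the leading positions is injective on [C]: a nonzero codeword does not vanish at
    its own leading position. *)
Lemma dim_leading_pos C :
  (\dim C <= \sum_i \sum_j leading_pos C i j)%N.
Proof.
pose P := [set p : 'I_n * 'I_m | leading_pos C p.1 p.2].
have -> : (\sum_i \sum_j leading_pos C i j = #|P|)%N.
  rewrite pair_bigA -sum1_card [RHS]big_mkcond; apply: eq_bigr => p _.
  by rewrite inE; case: leading_pos.
pose h (k : 'I_#|P|) := mxvec_index (enum_val k).1 (enum_val k).2.
pose f := linfun (colsub h \o @mxvec F n m).
rewrite -(@limg_dim_eq _ _ _ f) => [|].
  by apply: leq_trans (dimvS (subvf _)) _; rewrite dimvf dim_matrix -[leqLHS]/(1 * _)%N mul1n.
apply/eqP; rewrite -subv0; apply/subvP => M /memv_capP[MC].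
rewrite memv_ker lfunE /= memv0 => /eqP/rowP M0; apply: contraT => M_n0.
have [i [j Mij]] := exists_leading M_n0.
have ijP : (i, j) \in P by rewrite inE; apply/existsP; exists M; rewrite MC.
have := M0 (enum_rank_in ijP (i, j)); rewrite !mxE /h enum_rankK_in // mxvecE.
by have [/eqP] := leadingP Mij.
Qed.

End Leading.

(** * Linear maps that stay inside the row space *)

Section RowSpace.
Variable F : fieldType.

Lemma row_free_extend t d (y : 'rV[F]_d) (j : 'I_t) :
  (t <= d)%N -> y != 0 -> exists2 X : 'M[F]_(t, d), row_free X & row j X = y.
Proof.
move=> le_td; case/rV0Pn => c yc.
(* Row [a != j] will be the unit vector at [h a]. The transposition reserves for row [j] the column
   [c], where [y] is nonzero. *)
pose h a := tperm (widen_ord le_td j) c (widen_ord le_td a).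
have h_inj : injective h.
  by move=> a b /perm_inj/(congr1 val) /= /val_inj.
have hj : h j = c by rewrite /h tpermL.
exists (\matrix_a (if a == j then y else delta_mx 0 (h a))); last first.
  by rewrite rowK eqxx.
apply: inj_row_free => u /rowP u0; apply/rowP => a; rewrite [RHS]mxE.
have uj : u 0 j = 0.
  have := u0 c; rewrite !mxE (bigD1 j) //= big1 => [|b bj]; rewrite mxE.
    by rewrite addr0 eqxx => /eqP; rewrite mulf_eq0 (negPf yc) orbF => /eqP.
  by rewrite (negPf bj) mxE -hj (inj_eq h_inj) (eq_sym j) (negPf bj) andbF mulr0.
have [->//|aj] := eqVneq a j.
have := u0 (h a); rewrite !mxE (bigD1 a) //= big1 => [|b ba]; rewrite mxE.
  by rewrite addr0 (negPf aj) mxE !eqxx mulr1.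
have [->|bj] := eqVneq b j; first by rewrite uj mul0r.
by rewrite mxE (inj_eq h_inj) (eq_sym a) (negPf ba) andbF mulr0.
Qed.

(** Some hyperplane contains [w] but not [v]. As [t < m], it has room for [t] independent rows with
    [w] among them. *)
Lemma row_free_avoid t m (v w : 'rV[F]_m) (j : 'I_t) :
  (t < m)%N -> w != 0 -> ~~ (v <= w)%MS ->
  exists X : 'M[F]_(t, m), [/\ row_free X, row j X = w & ~~ (v <= X)%MS].
Proof.
move=> lt_tm w_n0; rewrite submxE => /rV0Pn[c vc].
pose u := col c (cokermx w).
have wu : w *m u = 0 by rewrite /u colE mulmxA mulmx_coker mul0mx.
(* The column [u] of the cokernel of [w] is the normal vector of the hyperplane. *)
have vu : v *m u != 0.
  apply: contraNneq vc; rewrite /u colE mulmxA -colE => /colP/(_ 0).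
  by rewrite 2!mxE => ->; rewrite mxE.
have rank_u : (t <= \rank (kermx u))%N.
  rewrite mxrank_ker leq_subRL; last by rewrite (leq_trans (rank_leq_row _)).
  by apply: leq_trans lt_tm; rewrite -[t.+1]add1n leq_add2r rank_leq_col.
have : (w <= row_base (kermx u))%MS by rewrite eq_row_base; apply/sub_kermxP.
case/submxP=> y wE.
have y_n0 : y != 0 by apply: contraNneq w_n0 => y0; rewrite wE y0 mul0mx.
have [X0 X0free X0j] := row_free_extend j rank_u y_n0.
exists (X0 *m row_base (kermx u)); split.
- by rewrite /row_free mxrankMfree ?row_base_free.
- by rewrite row_mul X0j.
- apply: contra vu => /submx_trans/(_ (submxMl _ _)).
  by rewrite eq_row_base => /sub_kermxP->.
Qed.

(** Unit vectors being eigenvectors makes [N] diagonal; the sum of the unit vectors [0] and [i]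
    being one makes diagonal entries [0] and [i] equal. *)
Lemma eigen_all_scalar m (N : 'M[F]_m) :
  (forall w : 'rV_m, (w *m N <= w)%MS) -> exists a, N = a%:M.
Proof.
case: m N => [|m] N stab; first by exists 0; apply/matrixP => -[].
have N0 i j : i != j -> N i j = 0.
  move=> ij; have /sub_rVP[a /rowP/(_ j)] := stab (delta_mx 0 i).
  by rewrite -rowE !mxE (eq_sym j) (negPf ij) andbF mulr0.
exists (N 0 0); apply/matrixP => i j; rewrite mxE.
have [<-|/N0->//] := eqVneq i j; rewrite mulr1n.
have [->//|i0] := eqVneq i 0.
have /sub_rVP[a] := stab (delta_mx 0 0 + delta_mx 0 i).
rewrite mulmxDl -!rowE => aE.
have := congr1 (fun u : 'rV_m.+1 => u 0 0) aE.
have := congr1 (fun u : 'rV_m.+1 => u 0 i) aE.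
rewrite !mxE !eqxx /= (negPf i0) (eq_sym 0 i) (negPf i0) (N0 _ _ i0).
by rewrite (N0 0 i) 1?eq_sym // !add0r !addr0 mulr1 => -> ->.
Qed.

(* For [j != i] and [X] with row [j] equal to [w], both [X] and the matrix
   obtained by adding [w] to row [i] of [X] have the same row space, hence
   [l (delta_mx i 0 *m w)] lies in every [t]-space through [w]. *)
Lemma row_in_rowspace t m (l : {linear 'M[F]_(t, m) -> 'rV[F]_m}) :
  (t < m)%N -> (forall X, row_free X -> (l X <= X)%MS) ->
  exists a : 'rV_t, forall X, l X = a *m X.
Proof.
move=> lt_tm l_row.
have l1 i (w : 'rV_m) : (l (delta_mx i 0 *m w) <= w)%MS.
  have [->|w_n0] := eqVneq w 0; first by rewrite mulmx0 linear0 sub0mx.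
  have [j /= ji|all_i] := pickP (fun j => j != i).
    apply: contraT => /(row_free_avoid j lt_tm w_n0)[X [Xfree Xj]].
    case/negP; pose U := 1%:M + delta_mx i j : 'M[F]_t.
    have XU : U *m X = X + delta_mx i 0 *m w.
      by rewrite mulmxDl mul1mx -Xj rowE mulmxA mul_delta_mx.
    have Ufree : row_free (U *m X).
      have UV : U *m (1%:M - delta_mx i j) = 1%:M.
        rewrite mulmxDl mul1mx mulmxBr mulmx1 mul_delta_mx_0 // subr0.
        by rewrite subrK.
      have [Uu _] := mulmx1_unit UV.
      by rewrite /row_free eqmxMfull ?row_full_unit.
    have -> : l (delta_mx i 0 *m w) = l (U *m X) - l X.
      by rewrite XU linearD addrC addKr.
    rewrite addmx_sub ?eqmx_opp ?l_row //.
    exact: submx_trans (l_row _ Ufree) (submxMl _ _).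
  (* Here [t = 1]: the matrix [delta_mx i 0 *m w] consists of the one row [w], so the hypothesis on
     [l] applies to it directly. *)
  suff wfree : row_free (delta_mx i 0 *m w).
    exact: submx_trans (l_row _ wfree) (submxMl _ _).
  apply: inj_row_free => v; rewrite mulmxA => vw.
  apply/rowP => k; have /eqP-> := negbFE (all_i k).
  have /rV0Pn[c wc] := w_n0; have /rowP/(_ c) := vw.
  rewrite -colE mxE big_ord1 !mxE => /eqP.
  by rewrite mulf_eq0 (negPf wc) orbF => /eqP.
(* [N i] represents the action of [l] on row [i] alone. By [l1] it is a scalar, which becomes the
   [i]-th entry of the vector sought. *)
pose N i : 'M_m := lin1_mx (l \o mulmx (delta_mx i 0)).
have N_scalar i : exists a, N i = a%:M.
  by apply: eigen_all_scalar => w; rewrite mul_rV_lin1 /= l1.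
have [a aE] := fin_all_exists N_scalar.
exists (\row_i a i) => X.
have XE : X = \sum_i delta_mx i 0 *m row i X.
  rewrite -[LHS]mul1mx mx1_sum_delta mulmx_suml; apply: eq_bigr => i _.
  by rewrite rowE mulmxA mul_delta_mx.
rewrite mulmx_sum_row {1}XE linear_sum; apply: eq_bigr => i _.
by rewrite mxE -mul_mx_scalar -aE mul_rV_lin1.
Qed.

End RowSpace.

(** * Structure of optimal anticodes *)

Section Anticode.
Variable F : finFieldType.

Lemma mxrank_maxrk n m (C : {vspace 'M[F]_(n, m)}) M :
  M \in C -> (\rank M <= maxrk C)%N.
Proof.
by move=> MC; apply: (@leq_bigmax_cond _ (fun M => M \in C) (fun M => \rank M)).
Qed.

Lemma maxrk_leq_row n m (C : {vspace 'M[F]_(n, m)}) : (maxrk C <= n)%N.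
Proof. by apply/bigmax_leqP => M _; apply: rank_leq_row. Qed.

Lemma leading_pos_constant n m (C : {vspace 'M[F]_(n, m)}) :
  (n <= m)%N -> optimal_anticode C ->
  (forall i a b, leading_pos C i a = leading_pos C i b) \/
  (m = n /\ forall i j a, leading_pos C i a = leading_pos C j a).
Proof.
move=> le_nm optC.
(* The [n] by [m] array of leading positions is padded with empty rows to a square one. *)
pose f (i j : 'I_m) :=
  if insub (i : nat) is Some i0 then leading_pos C (i0 : 'I_n) j else false.
have fE i j : f (widen_ord le_nm i) j = leading_pos C i j.
  by rewrite /f /= valK.
have f_out (i j : 'I_m) : ~~ (i < n)%N -> f i j = false.
  by move=> ni; rewrite /f insubN.
have sumE (h : 'I_m -> nat) : (forall i : 'I_m, ~~ (i < n)%N -> h i = 0%N) ->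
    (\sum_i h i = \sum_(i < n) h (widen_ord le_nm i))%N.
  move=> h0; rewrite (bigID (fun i : 'I_m => (i < n)%N)) /= [X in (_ + X)%N]big1 //.
  by rewrite addn0 (big_ord_narrow le_nm).
have f_le (s : {perm 'I_m}) : (\sum_i f i (s i) <= maxrk C)%N.
  rewrite sumE => [|i ni]; last by rewrite f_out.
  under eq_bigr => i _ do rewrite fE.
  have s_inj : injective (s \o widen_ord le_nm).
    by move=> i j /perm_inj/(congr1 val) /= /val_inj.
  have [M MC le_M] := leading_rank C s_inj.
  exact: leq_trans le_M (mxrank_maxrk MC).
have f_ge : (m * maxrk C <= \sum_i \sum_j f i j)%N.
  rewrite -optC sumE => [|i ni]; last by rewrite big1 // => j _; rewrite f_out.
  under eq_bigr => i _ do under eq_bigr => j _ do rewrite fE.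
  exact: dim_leading_pos.
have [rowf|colf] := transversal_constant f_le f_ge.
  by left=> i a b; rewrite -!fE.
have := le_nm; rewrite leq_eqVlt => /predU1P[nm|lt_nm].
  by right; split=> // i j a; rewrite -!fE.
(* If [n < m], the padded row [n] is empty, so an array whose rows are all equal is empty as
   well. *)
left=> i a b; rewrite -!fE.
by rewrite !(colf _ (Ordinal lt_nm)) !f_out //= ltnn.
Qed.

(** A codeword is determined by its rows in [I], and by dimension these rows are arbitrary. The map
    [s] recovering the codeword from them is linear, and the rank bound keeps every row of [s X] in
    the row space of [X], so [s] is left multiplication by a fixed [A]. *)
Lemma anticode_image n m t (C : {vspace 'M[F]_(n, m)}) (I : {set 'I_n}) :
    (0 < m)%N -> (n <= m)%N -> optimal_anticode C -> maxrk C = t ->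
    (#|I| <= t)%N ->
    (forall M, M \in C -> (forall i, i \in I -> row i M = 0) -> M = 0) ->
  exists2 A : 'M[F]_(n, t), exists G : 'M_(t, n), G *m A = 1%:M
    & C = limg (linfun (mulmx A : 'M_(t, m) -> 'M_(n, m))).
Proof.
move=> m_gt0 le_nm optC tE leI C_I.
have dimC : \dim C = (t * m)%N by rewrite optC tE mulnC.
(* If [t = n], then [C] is the whole space and [A] is the identity; otherwise [t < m], as
   [row_in_rowspace] requires. *)
have [tn|t_n] := eqVneq t n.
  subst t; move: dimC; rewrite tn => dimC; exists 1%:M.
    by exists 1%:M; rewrite mul1mx.
  have -> : C = fullv.
    by apply/eqP; rewrite eqEdim subvf /= dimvf dim_matrix dimC.
  apply/eqP; rewrite eqEsubv subvf andbT; apply/subvP => M _.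
  by apply/memv_imgP; exists M; rewrite ?memvf // lfunE /= mul1mx.
have lt_tm : (t < m)%N.
  by apply: leq_trans le_nm; rewrite ltn_neqAle t_n -tE maxrk_leq_row.
pose g : 'I_#|I| -> 'I_n := enum_val.
have C_g M : M \in C -> rowsub g M = 0 -> M = 0.
  move=> MC gM; apply: C_I => // i iI.
  have := congr1 (row (enum_rank_in iI i)) gM.
  by rewrite row_rowsub /g enum_rankK_in // row0.
pose p : 'Hom('M[F]_(n, m), 'M[F]_(#|I|, m)) := linfun (rowsub g).
have p_C : (C :&: lker p = 0)%VS.
  apply/eqP; rewrite -subv0; apply/subvP => M /memv_capP[MC].
  by rewrite memv_ker lfunE /= memv0 => /eqP/(C_g _ MC)->.
have cardI : #|I| = t.
  apply/eqP; rewrite eqn_leq leI -(leq_pmul2r m_gt0) -dimC -(limg_dim_eq p_C).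
  by apply: leq_trans (dimvS (subvf _)) _; rewrite dimvf dim_matrix.
subst t; rewrite -cardI in lt_tm dimC *.
pose f := (p \o projv C)%VF.
have f_full : limg f = fullv.
  apply/eqP; rewrite eqEdim subvf /= dimvf dim_matrix -[leqLHS]/(#|I| * m)%N.
  rewrite -dimC -(limg_dim_eq p_C).
  apply: dimvS; apply/subvP => _ /memv_imgP[M MC ->]; apply/memv_imgP.
  by exists M; rewrite ?memvf // comp_lfunE projv_id.
(* [f] is the restriction to the rows in [I], precomposed with a projection onto [C]; thus [s] is a
   section of the restriction with values in [C]. *)
pose s := (projv C \o f^-1)%VF.
have sC X : s X \in C by rewrite comp_lfunE memv_proj.
have sK X : rowsub g (s X) = X.
  have : f (f^-1%VF X) = X by rewrite limg_lfunVK // f_full memvf.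
  by rewrite !comp_lfunE lfunE.
have Ks M : M \in C -> s (rowsub g M) = M.
  move=> MC; apply/eqP; rewrite -subr_eq0; apply/eqP/C_g.
    by rewrite rpredB.
  by rewrite linearB /= sK subrr.
have s_row r : exists a : 'rV_#|I|, forall X, row r (s X) = a *m X.
  apply: (row_in_rowspace (l := row r \o s)) lt_tm _ => X Xfree /=.
  apply: submx_trans (row_sub r (s X)) _.
  (* [X] occurs among the rows of [s X], whose rank is at most [maxrk C = \rank X]; the two row
     spaces therefore coincide. *)
  have Xs : (X <= s X)%MS by rewrite -{1}(sK X) rowsub_sub.
  rewrite -(geq_leqif (mxrank_leqif_sup Xs)) (etrans (eqP Xfree) cardI).
  exact: mxrank_maxrk.
have [a aE] := fin_all_exists s_row.
pose A := \matrix_r a r.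
have sE X : s X = A *m X.
  by apply/row_matrixP => r; rewrite row_mul rowK aE.
exists A.
  (* The identity [G *m A *m X = X] is known only for [X] with [m] columns; since [0 < m], unit
     matrices supported in column [j] recover [G *m A = 1]. *)
  exists (rowsub g 1%:M); apply/matrixP => i k; pose j := Ordinal m_gt0.
  have GA (X : 'M_(_, m)) : rowsub g 1%:M *m A *m X = X.
    by rewrite -mulmxA -sE mul_rowsub_mx mul1mx sK.
  have /matrixP/(_ i j) := GA (delta_mx k j).
  rewrite mxE (bigD1 k) //= [delta_mx k j i j]mxE big1 => [|l lk]; last first.
    by rewrite [delta_mx k j l j]mxE (negPf lk) mulr0.
  by rewrite [delta_mx k j k j]mxE !eqxx mulr1 addr0 andbT => ->; rewrite mxE.
apply/vspaceP => M; apply/idP/memv_imgP => [MC|[X _ ->]].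
  by exists (rowsub g M); rewrite ?memvf // lfunE /= -sE Ks.
by rewrite lfunE /= -sE.
Qed.

Definition trv n m (C : {vspace 'M[F]_(n, m)}) : {vspace 'M[F]_(m, n)} :=
  (linfun trmx @: C)%VS.

Lemma mem_trv n m (C : {vspace 'M[F]_(n, m)}) M : (M \in trv C) = (M^T \in C).
Proof.
apply/memv_imgP/idP => [[N NC ->]|MC]; first by rewrite lfunE /= trmxK.
by exists M^T; rewrite // lfunE /= trmxK.
Qed.

Lemma dim_trv n m (C : {vspace 'M[F]_(n, m)}) : \dim (trv C) = \dim C.
Proof.
apply: limg_dim_eq; apply/eqP; rewrite -subv0; apply/subvP => M /memv_capP[_].
by rewrite memv_ker lfunE /= memv0 trmx_eq0.
Qed.

Lemma maxrk_trv n m (C : {vspace 'M[F]_(n, m)}) : maxrk (trv C) = maxrk C.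
Proof.
apply/eqP; rewrite eqn_leq; apply/andP; split; apply/bigmax_leqP => M.
  by rewrite mem_trv -mxrank_tr; apply: mxrank_maxrk.
by rewrite -mxrank_tr => MC; apply: mxrank_maxrk; rewrite mem_trv trmxK.
Qed.

(* [C] is the code of all matrices with column space inside that of [A]. *)
Definition image_code n m (C : {vspace 'M[F]_(n, m)}) : Prop :=
  exists2 A : 'M[F]_(n, maxrk C), exists G : 'M_(maxrk C, n), G *m A = 1%:M
    & C = limg (linfun (mulmx A : 'M_(maxrk C, m) -> 'M_(n, m))).

(** [I] collects the rows filled with leading positions: a codeword vanishing there has nowhere to
    lead. A diagonal meets each such row once, so [leading_rank] bounds [#|I|] by [maxrk C]. Filled
    columns are treated as rows of the transposed code. *)
Lemma optimal_image_code n m (C : {vspace 'M[F]_(n, m)}) :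
  (0 < n)%N -> (n <= m)%N -> optimal_anticode C ->
  image_code C \/ (m = n /\ image_code (trv C)).
Proof.
move=> n_gt0 le_nm optC; have m_gt0 := leq_trans n_gt0 le_nm.
have [rowC|[mn colC]] := leading_pos_constant le_nm optC.
  left; apply: (anticode_image (I := [set i | leading_pos C i (Ordinal m_gt0)])) => //.
    have w_inj : injective (widen_ord le_nm).
      by move=> i j /(congr1 val) /= /val_inj.
    have [M MC le_M] := leading_rank C w_inj.
    apply: leq_trans (mxrank_maxrk MC); apply: leq_trans le_M.
    rewrite -sum1_card big_mkcond; apply: leq_sum => i _.
    by rewrite inE (rowC i _ (Ordinal m_gt0)); case: leading_pos.
  move=> M MC M0; apply/eqP; apply: contraT => /exists_leading[i [j Mij]].
  have iI : i \in [set i | leading_pos C i (Ordinal m_gt0)].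
    by rewrite inE (rowC _ _ j); apply/existsP; exists M; rewrite MC.
  have [/eqP] := leadingP Mij; case.
  by have /rowP/(_ j) := M0 i iI; rewrite !mxE.
right; split=> //; subst m.
have optT : optimal_anticode (trv C) by rewrite /optimal_anticode dim_trv maxrk_trv.
pose i0 := Ordinal n_gt0.
apply: (anticode_image (I := [set j | leading_pos C i0 j])) => //.
  have [M MC le_M] := leading_rank C (s := id) (fun i j e => e).
  rewrite maxrk_trv; apply: leq_trans (mxrank_maxrk MC); apply: leq_trans le_M.
  rewrite -sum1_card big_mkcond; apply: leq_sum => i _.
  by rewrite inE (colC i0 i); case: leading_pos.
move=> M; rewrite mem_trv => MC M0; apply/eqP; rewrite -trmx_eq0.
apply: contraT => /exists_leading[i [j Mij]].
have jI : j \in [set j | leading_pos C i0 j].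
  by rewrite inE (colC _ i); apply/existsP; exists M^T; rewrite MC.
have [/eqP] := leadingP Mij; case.
by have /rowP/(_ i) := M0 j jI; rewrite !mxE.
Qed.

End Anticode.

(** * Rank functions computed through generator matrices *)

Section Rho.
Variable F : finFieldType.

Lemma exists_basis_mx N (J : {vspace 'rV[F]_N}) :
  exists k, exists B : 'M[F]_(k, N), forall u, (u \in J) = (u <= B)%MS.
Proof.
exists (\dim J), (\matrix_i (vbasis J)`_i) => u.
apply/idP/submxP => [uJ|[y ->]].
  exists (\row_i coord (vbasis J) i u).
  rewrite {1}(coord_vbasis uJ) mulmx_sum_row.
  by apply: eq_bigr => i _; rewrite mxE rowK.
rewrite mulmx_sum_row; apply: rpred_sum => i _; rewrite rowK rpredZ //.
by apply: vbasis_mem; rewrite mem_nth // size_tuple.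
Qed.

Lemma exists_row_vspace k N (B : 'M[F]_(k, N)) :
  exists J : {vspace 'rV[F]_N}, forall u, (u \in J) = (u <= B)%MS.
Proof.
exists (limg (linfun (mulmxr B : 'rV_k -> 'rV_N))) => u.
apply/memv_imgP/submxP => [[y _ ->]|[y ->]]; exists y;
  by rewrite ?memvf // lfunE.
Qed.

(** Removes the span from [perpv], [subcode_c] and [subcode_r], whose spanning sets are already
    subspaces. *)
Lemma span_enum_vspace n m (U : {vspace 'M[F]_(n, m)}) (p : pred 'M[F]_(n, m)) :
  (forall x, p x = (x \in U)) -> <<[seq x <- enum 'M[F]_(n, m) | p x]>>%VS = U.
Proof.
move=> pU; apply/eqP; rewrite eqEsubv; apply/andP; split.
  by apply/span_subvP => x; rewrite mem_filter pU => /andP[].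
by apply/subvP => x xU; apply: memv_span; rewrite mem_filter pU xU mem_enum.
Qed.

Section Perp.
Variables (N k : nat) (B : 'M[F]_(k, N)) (J : {vspace 'rV[F]_N}).
Hypothesis JB : forall u, (u \in J) = (u <= B)%MS.

Lemma mem_perpv v : (v \in perpv J) = (B *m v^T == 0).
Proof.
rewrite /perpv (span_enum_vspace (U := lker (linfun (mulmx B \o trmx)))).
  by rewrite memv_ker lfunE.
move=> {}v; rewrite memv_ker lfunE /=; apply/forallP/eqP => [JP|Bv u].
  apply/row_matrixP => i; rewrite row_mul row0; apply/eqP.
  by have := JP (row i B); rewrite JB row_sub.
by apply/implyP; rewrite JB => /submxP[y ->]; rewrite -mulmxA Bv mulmx0.
Qed.

Lemma subcode_cE m (C : {vspace 'M[F]_(N, m)}) :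
  subcode_c C (perpv J) = (C :&: lker (linfun (mulmx B)))%VS.
Proof.
apply: span_enum_vspace => M; rewrite memv_cap memv_ker lfunE /=.
congr (_ && _); apply/forallP/eqP => [cM|BM j].
  apply/matrixP => i j; have := cM j; rewrite mem_perpv trmxK colE mulmxA -colE.
  by move=> /eqP/colP/(_ i); rewrite !mxE.
by rewrite mem_perpv trmxK colE mulmxA BM mul0mx.
Qed.

Lemma subcode_rE n (C : {vspace 'M[F]_(n, N)}) :
  subcode_r C (perpv J) = (C :&: lker (linfun (mulmx B \o trmx)))%VS.
Proof.
apply: span_enum_vspace => M; rewrite memv_cap memv_ker lfunE /=.
congr (_ && _); apply/forallP/eqP => [cM|BM i].
  apply/matrixP => i j; have := cM j; rewrite mem_perpv tr_row colE mulmxA -colE.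
  by move=> /eqP/colP/(_ i); rewrite !mxE.
by rewrite mem_perpv tr_row colE mulmxA BM mul0mx.
Qed.

(** The subcode is the kernel of left multiplication by [B] on [C], so this is rank-nullity. *)
Lemma rho_cE m (C : {vspace 'M[F]_(N, m)}) :
  rho_c C J = (\dim (linfun (mulmx B) @: C))%:R / m%:R.
Proof.
rewrite /rho_c subcode_cE -[in LHS](limg_ker_dim (linfun (mulmx B)) C).
by rewrite natrD addrC addKr.
Qed.

Lemma rho_rE n (C : {vspace 'M[F]_(n, N)}) : rho_r C J = rho_c (trv C) J.
Proof.
rewrite rho_cE /rho_r subcode_rE -[in LHS](limg_ker_dim (linfun (mulmx B \o trmx)) C).
rewrite natrD addrC addKr /trv -limg_comp; congr ((\dim (_ @: _))%:R / _).
by apply/lfunP => M; rewrite comp_lfunE !lfunE.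
Qed.

End Perp.

Lemma rho_r_trv n m (C : {vspace 'M[F]_(n, m)}) J : rho_r C J = rho_c (trv C) J.
Proof. by have [k [B JB]] := exists_basis_mx J; exact: (rho_rE JB). Qed.

Lemma rho_c_fullv n m (C : {vspace 'M[F]_(n, m)}) :
  rho_c C fullv = (\dim C)%:R / m%:R.
Proof.
rewrite (rho_cE (B := 1%:M)) => [|u]; last by rewrite memvf submx1.
rewrite limg_dim_eq //; apply/eqP; rewrite -subv0; apply/subvP => M /memv_capP[_].
by rewrite memv_ker lfunE /= mul1mx memv0.
Qed.

Lemma rho_c_le_fullv n m (C : {vspace 'M[F]_(n, m)}) J :
  rho_c C J <= rho_c C fullv.
Proof.
by rewrite rho_c_fullv ler_wpM2r ?invr_ge0 ?ler0n // lerBlDr lerDl ler0n.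
Qed.

(** In the factorization of [N] as [col_base N *m row_base N], the right factor has a right inverse,
    so it does not shrink the image; the left factor has a left inverse, so it acts injectively. *)
Lemma dim_limg_mulmx k t m (N : 'M[F]_(k, t)) :
  \dim (limg (linfun (mulmx N : 'M_(t, m) -> 'M_(k, m)))) = (\rank N * m)%N.
Proof.
have [R' RK] : exists R', row_base N *m R' = 1%:M.
  exact/row_freeP/row_base_free.
have NR : N *m R' = col_base N.
  by have := congr1 (mulmx (col_base N)) RK; rewrite mulmxA mulmx_base mulmx1.
have [L' LK] : exists L', L' *m col_base N = 1%:M.
  exact/row_fullP/col_base_full.
have -> : limg (linfun (mulmx N : 'M_(t, m) -> 'M_(k, m)))
          = limg (linfun (mulmx (col_base N) : 'M_(_, m) -> 'M_(k, m))).
  apply/vspaceP => M; apply/memv_imgP/memv_imgP => -[X _ ->].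
    exists (row_base N *m X); rewrite ?memvf // !lfunE /=.
    by rewrite mulmxA mulmx_base.
  exists (R' *m X); rewrite ?memvf // !lfunE /=.
  by rewrite mulmxA NR.
rewrite limg_dim_eq; first by rewrite dimvf dim_matrix.
apply/eqP; rewrite -subv0; apply/subvP => X /memv_capP[_].
rewrite memv_ker lfunE /= memv0 => /eqP X0.
by rewrite -[X]mul1mx -LK -mulmxA X0 mulmx0.
Qed.

Lemma rho_c_image k n m t (A : 'M[F]_(n, t)) (B : 'M[F]_(k, n))
    (J : {vspace 'rV[F]_n}) :
  (0 < m)%N -> (forall u, (u \in J) = (u <= B)%MS) ->
  rho_c (limg (linfun (mulmx A : 'M_(t, m) -> 'M_(n, m)))) J = (\rank (B *m A))%:R.
Proof.
move=> m_gt0 JB; rewrite (rho_cE JB) -limg_comp.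
have -> : (linfun (mulmx B) \o linfun (mulmx A : 'M_(t, m) -> 'M_(n, m)))%VF
          = linfun (mulmx (B *m A)).
  by apply/lfunP => M; rewrite comp_lfunE !lfunE /= mulmxA.
by rewrite dim_limg_mulmx natrM mulfK // pnatr_eq0 -lt0n.
Qed.

Lemma rho_c_image_code n m (C : {vspace 'M[F]_(n, m)}) (r : rat) :
  (0 < m)%N -> image_code C ->
  (exists J, rho_c C J = r) <-> (exists2 k : nat, (k <= maxrk C)%N & r = k%:R).
Proof.
move=> m_gt0 [A [G GA] CE]; split=> [[J <-]|[k le_k ->]].
  have [k [B JB]] := exists_basis_mx J.
  exists (\rank (B *m A)); first exact: rank_leq_col.
  by rewrite {1}CE (rho_c_image A m_gt0 JB).
(* With [G *m A = 1], this choice of [B] makes [B *m A] equal to [pid_mx k], of rank [k]. *)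
have [J JB] := exists_row_vspace (pid_mx k *m G : 'M_(maxrk C, n)).
exists J; rewrite {1}CE (rho_c_image A m_gt0 JB) -mulmxA GA mulmx1.
by rewrite rank_pid_mx.
Qed.

Lemma optimal_rho_fullv n m (C : {vspace 'M[F]_(n, m)}) : (0 < m)%N ->
  optimal_anticode C <-> rho_c C fullv = (maxrk C)%:R.
Proof.
move=> m_gt0; have m_n0 : m%:R != 0 :> rat by rewrite pnatr_eq0 -lt0n.
rewrite rho_c_fullv /optimal_anticode; split=> [->|].
  by rewrite mulnC natrM mulfK.
by move/(canRL (divfK m_n0)); rewrite -natrM mulnC => /eqP; rewrite eqr_nat => /eqP.
Qed.

(** [rho_c C] is largest at the full space, so its value there is the maximum [t] of the range. *)
Lemma rho_c_range_fullv n m (C : {vspace 'M[F]_(n, m)}) t :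
  (forall r : rat, (exists J, rho_c C J = r) <->
                   (exists2 k : nat, (k <= t)%N & r = k%:R)) ->
  rho_c C fullv = t%:R.
Proof.
move=> range; have [|k le_kt kE] := (range (rho_c C fullv)).1; first by exists fullv.
have [|J JE] := (range t%:R).2; first by exists t.
have := rho_c_le_fullv C J; rewrite JE kE ler_nat => le_tk.
by congr _%:R; apply/eqP; rewrite eqn_leq le_kt.
Qed.

End Rho.

Theorem theorem6p2 (F : finFieldType) (n m : nat) (C : {vspace 'M[F]_(n, m)}) :
  (2 <= n)%N -> (n <= m)%N ->
  [/\ (optimal_anticode C <->
        ((forall r : rat, (exists J : {vspace 'rV[F]_n}, rho_c C J = r) <->
                          (exists2 k : nat, (k <= maxrk C)%N & r = k%:R))
         \/ (m = n /\
             forall r : rat, (exists K : {vspace 'rV[F]_m}, rho_r C K = r) <->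
                             (exists2 k : nat, (k <= maxrk C)%N & r = k%:R)))),
      (optimal_anticode C <->
        (rho_c C fullv = (maxrk C)%:R \/
         (m = n /\ rho_r C fullv = (maxrk C)%:R)))
    & (optimal_anticode C ->
        (forall J : {vspace 'rV[F]_n}, exists k : nat, rho_c C J = k%:R) \/
        (m = n /\ forall K : {vspace 'rV[F]_m}, exists k : nat, rho_r C K = k%:R))].
Proof.
move=> n_ge2 le_nm; have n_gt0 : (0 < n)%N := ltnW n_ge2.
have m_gt0 := leq_trans n_gt0 le_nm.
have rho_rTE r : (exists K, rho_r C K = r) <-> (exists K, rho_c (trv C) K = r).
  by split=> -[K KE]; exists K; rewrite -KE rho_r_trv.
have opt_rho : optimal_anticode C <->
    rho_c C fullv = (maxrk C)%:R \/ (m = n /\ rho_r C fullv = (maxrk C)%:R).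
  split=> [/(optimal_rho_fullv C m_gt0)|]; first by left.
  case=> [/(optimal_rho_fullv C m_gt0)//|[mn]].
  rewrite rho_r_trv -maxrk_trv => /(optimal_rho_fullv (trv C) n_gt0).
  (* Optimality of the transposed code carries the factor [n], which [m = n] turns into [m]. *)
  by rewrite /optimal_anticode dim_trv maxrk_trv => ->; congr muln.
have opt_range : optimal_anticode C ->
    (forall r : rat, (exists J, rho_c C J = r) <->
                     (exists2 k : nat, (k <= maxrk C)%N & r = k%:R))
    \/ (m = n /\ forall r : rat, (exists K, rho_r C K = r) <->
                     (exists2 k : nat, (k <= maxrk C)%N & r = k%:R)).
  move=> /(optimal_image_code n_gt0 le_nm)[imC|[mn imC]].
    by left=> r; apply: rho_c_image_code.
  right; split=> // r; apply: iff_trans (rho_rTE r) _.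
  by rewrite -maxrk_trv; apply: rho_c_image_code.
split=> //.
- split=> //; case=> [/rho_c_range_fullv rhoC|[mn rangeT]]; apply/opt_rho.
    by left.
  right; split=> //; rewrite rho_r_trv; apply: rho_c_range_fullv => r.
  exact: iff_trans (iff_sym (rho_rTE r)) (rangeT r).
- move=> /opt_range[rangeC|[mn rangeC]]; [left|right; split=> //].
    move=> J; have [|k _ ->] := (rangeC (rho_c C J)).1; first by exists J.
    by exists k.
  move=> K; have [|k _ ->] := (rangeC (rho_r C K)).1; first by exists K.
  by exists k.
Qed.
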